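(* Let $A \in Sp(2)$ be a $2\times 2$ symplectic matrix. Then $A$ has infinitely many left eigenvalues if and only if there exist a quaternion $q\in\mathbb{H}$ with $\vert q\vert = 1$ and a real number $\theta$ with $\sin\theta\neq 0$ such that $$A=\begin{bmatrix} q\cos\theta & -q\sin\theta\\ q\sin\theta & q\cos\theta\end{bmatrix}.$$
   Context: $\mathbb{H}$ denotes the algebra of real quaternions, with norm $\vert\cdot\vert$, and $\mathbb{H}^2$ is considered as a right vector space over $\mathbb{H}$. A left eigenvalue of a $2\times 2$ quaternionic matrix $A$ is a quaternion $\lambda\in\mathbb{H}$ such that there exists $u\in\mathbb{H}^2$, $u\neq 0$, with $Au=\lambda u$ (where $\lambda u$ is obtained by multiplying each coordinate of $u$ by $\lambda$ on the left). $Sp(2)$ is the group of $2\times 2$ symplectic matrices, that is, $2\times 2$ quaternionic matrices $A$ with $A^*A=I$, where $A^*$ is the conjugate transpose of $A$. *)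

(* Defs.v *)
From HB Require Import structures.
From mathcomp Require Import all_boot all_order all_algebra ring.
From mathcomp Require Import all_classical all_reals all_analysis.

Set Implicit Arguments.
Unset Strict Implicit.
Unset Printing Implicit Defensive.
Import Order.TTheory GRing.Theory Num.Theory.
Local Open Scope ring_scope.

(* [Quat a b c d] is a + b i + c j + d k. *)
Record quaternion (R : Type) := Quat { qre : R; qi : R; qj : R; qk : R }.

Definition tuple_of_quat (R : Type) (q : quaternion R) : R * R * R * R :=
  (qre q, qi q, qj q, qk q).
Definition quat_of_tuple (R : Type) (t : R * R * R * R) : quaternion R :=
  let: (a, b, c, d) := t in Quat a b c d.
Lemma tuple_of_quatK (R : Type) :
  cancel (@tuple_of_quat R) (@quat_of_tuple R).
Proof. by case. Qed.

HB.instance Definition _ (R : eqType) :=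
  Equality.copy (quaternion R) (can_type (@tuple_of_quatK R)).
HB.instance Definition _ (R : choiceType) :=
  Choice.copy (quaternion R) (can_type (@tuple_of_quatK R)).

Definition qzero (R : zmodType) : quaternion R := Quat 0 0 0 0.
Definition qopp (R : zmodType) (p : quaternion R) : quaternion R :=
  let: Quat a b c d := p in Quat (- a) (- b) (- c) (- d).
Definition qadd (R : zmodType) (p q : quaternion R) : quaternion R :=
  let: Quat a b c d := p in let: Quat a' b' c' d' := q in
  Quat (a + a') (b + b') (c + c') (d + d').

Lemma qaddA (R : zmodType) : associative (@qadd R).
Proof. by case=> ? ? ? ? [? ? ? ?] [? ? ? ?]; rewrite /= !addrA. Qed.
Lemma qaddC (R : zmodType) : commutative (@qadd R).
Proof. by case=> a b c d [a' b' c' d'] /=; congr Quat; rewrite addrC. Qed.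
Lemma qadd0 (R : zmodType) : left_id (qzero R) (@qadd R).
Proof. by case=> ? ? ? ?; rewrite /= !add0r. Qed.
Lemma qaddN (R : zmodType) : left_inverse (qzero R) (@qopp R) (@qadd R).
Proof. by case=> ? ? ? ?; rewrite /= !addNr. Qed.

HB.instance Definition _ (R : zmodType) :=
  GRing.isZmodule.Build (quaternion R)
    (@qaddA R) (@qaddC R) (@qadd0 R) (@qaddN R).

Definition qone (R : comNzRingType) : quaternion R := Quat 1 0 0 0.
(* Hamilton product: i^2 = j^2 = k^2 = i j k = -1. *)
Definition qmul (R : comNzRingType) (p q : quaternion R) : quaternion R :=
  let: Quat a b c d := p in let: Quat a' b' c' d' := q in
  Quat (a * a' - b * b' - c * c' - d * d')
       (a * b' + b * a' + c * d' - d * c')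
       (a * c' - b * d' + c * a' + d * b')
       (a * d' + b * c' - c * b' + d * a').

Lemma qmulA (R : comNzRingType) : associative (@qmul R).
Proof. by case=> ? ? ? ? [? ? ? ?] [? ? ? ?]; congr Quat; ring. Qed.
Lemma qmul1l (R : comNzRingType) : left_id (qone R) (@qmul R).
Proof. by case=> ? ? ? ?; congr Quat; ring. Qed.
Lemma qmul1r (R : comNzRingType) : right_id (qone R) (@qmul R).
Proof. by case=> ? ? ? ?; congr Quat; ring. Qed.
Lemma qmulDl (R : comNzRingType) : left_distributive (@qmul R) (@qadd R).
Proof. by case=> ? ? ? ? [? ? ? ?] [? ? ? ?]; congr Quat; ring. Qed.
Lemma qmulDr (R : comNzRingType) : right_distributive (@qmul R) (@qadd R).
Proof. by case=> ? ? ? ? [? ? ? ?] [? ? ? ?]; congr Quat; ring. Qed.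
Lemma qone_neq0 (R : comNzRingType) : qone R != qzero R.
Proof. by apply/eqP => -[] /eqP; rewrite oner_eq0. Qed.

HB.instance Definition _ (R : comNzRingType) :=
  GRing.Zmodule_isNzRing.Build (quaternion R)
    (@qmulA R) (@qmul1l R) (@qmul1r R) (@qmulDl R) (@qmulDr R) (@qone_neq0 R).

Definition qreal (R : zmodType) (x : R) : quaternion R := Quat x 0 0 0.

Definition qconj (R : zmodType) (q : quaternion R) : quaternion R :=
  let: Quat a b c d := q in Quat a (- b) (- c) (- d).

Definition qnorm (R : rcfType) (q : quaternion R) : R :=
  Num.sqrt (qre q ^+ 2 + qi q ^+ 2 + qj q ^+ 2 + qk q ^+ 2).

Definition conjtr (R : comNzRingType) (m n : nat)
    (A : 'M[quaternion R]_(m, n)) : 'M[quaternion R]_(n, m) :=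
  (map_mx (@qconj R) A)^T.

Definition symplectic (R : comNzRingType) (n : nat)
    (A : 'M[quaternion R]_n) : Prop :=
  conjtr A *m A = 1%:M.

(* [*:] on matrices multiplies every entry by the scalar on the left. *)
Definition left_eigenvalue (R : comNzRingType) (n : nat)
    (A : 'M[quaternion R]_n) (lambda : quaternion R) : Prop :=
  exists2 u : 'cV[quaternion R]_n, u != 0 & A *m u = lambda *: u.

Definition mx22 (T : Type) (a b c d : T) : 'M[T]_2 :=
  \matrix_(i < 2, j < 2)
    if i == 0 then (if j == 0 then a else b) else (if j == 0 then c else d).

(* Main.v *)
(* For A = [a, b; c, d] with b <> 0, the left eigenvalues are the a + b y with
   (1, y) an eigenvector, that is, with y a root of y^2 + p y + r = 0 where
   b p = a - d and b r = - c. The inverse of the difference of two roots solves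
   an affine equation, so as soon as there are three roots they all satisfy
   2 Re y = - Re p; then y^2 = 2 Re(y) y - |y|^2 turns the equation into
   (p - Re p) y = |y|^2 - r. If p were not real, |y|^2 would determine y and be
   a root of a monic real quadratic, leaving at most two roots. Hence p is real
   and r = |y|^2 >= 0. The relations A^* A = I then give r = 1 and p = 0, i.e.
   c = - b and d = a, with a a real multiple of b. *)
Require Import Defs.
From mathcomp Require Import all_boot all_order all_algebra ring lra.
From mathcomp Require Import all_classical all_reals all_analysis.

Set Implicit Arguments.
Unset Strict Implicit.
Unset Printing Implicit Defensive.

Import Order.TTheory GRing.Theory Num.Theory.
Local Open Scope classical_set_scope.
Local Open Scope ring_scope.

(** * Quaternion arithmetic: conjugation, real part and squared norm *)

Section Quaternions.
Variable R : comNzRingType.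
Implicit Types p q : quaternion R.

(** The norm is kept squared to avoid roots: identities about it are polynomial, hence within reach
    of [ring] over any commutative ring. *)
Definition qnorm2 q : R := qre q ^+ 2 + qi q ^+ 2 + qj q ^+ 2 + qk q ^+ 2.

Lemma mulqE (a b c d a' b' c' d' : R) : Quat a b c d * Quat a' b' c' d' =
  Quat (a * a' - b * b' - c * c' - d * d')
       (a * b' + b * a' + c * d' - d * c')
       (a * c' - b * d' + c * a' + d * b')
       (a * d' + b * c' - c * b' + d * a').
Proof. by []. Qed.

Lemma addqE (a b c d a' b' c' d' : R) :
  Quat a b c d + Quat a' b' c' d' = Quat (a + a') (b + b') (c + c') (d + d').
Proof. by []. Qed.

Lemma oppqE (a b c d : R) : - Quat a b c d = Quat (- a) (- b) (- c) (- d).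
Proof. by []. Qed.

Lemma zeroqE : 0 = Quat 0 0 0 0 :> quaternion R. Proof. by []. Qed.

Lemma oneqE : 1 = Quat 1 0 0 0 :> quaternion R. Proof. by []. Qed.

Definition quatE := (mulqE, addqE, oppqE, zeroqE, oneqE).

Lemma qreD p q : qre (p + q) = qre p + qre q.
Proof. by case: p => ????; case: q. Qed.

Lemma qreN q : qre (- q) = - qre q.
Proof. by case: q. Qed.

Lemma qrealM (x y : R) : qreal (x * y) = qreal x * qreal y.
Proof. by rewrite /qreal quatE; congr Quat; ring. Qed.

Lemma qreal_comm (x : R) q : qreal x * q = q * qreal x.
Proof. by case: q => a b c d; rewrite /qreal quatE; congr Quat; ring. Qed.

Lemma qnorm2M p q : qnorm2 (p * q) = qnorm2 p * qnorm2 q.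
Proof.
by case: p => a b c d; case: q => a' b' c' d'; rewrite quatE /qnorm2 /=; ring.
Qed.

Lemma qnorm2N q : qnorm2 (- q) = qnorm2 q.
Proof. by case: q => a b c d; rewrite quatE /qnorm2 /= !sqrrN. Qed.

Lemma qnorm2_conj q : qnorm2 (qconj q) = qnorm2 q.
Proof. by case: q => a b c d; rewrite /qnorm2 /= !sqrrN. Qed.

Lemma qnorm2_real (x : R) : qnorm2 (qreal x) = x ^+ 2.
Proof. by rewrite /qnorm2 /=; ring. Qed.

Lemma qconjK q : qconj (qconj q) = q.
Proof. by case: q => *; rewrite /= !opprK. Qed.

Lemma qconjN q : qconj (- q) = - qconj q.
Proof. by case: q. Qed.

Lemma qconjM p q : qconj (p * q) = qconj q * qconj p.
Proof.
by case: p => ????; case: q => *; rewrite /qconj !quatE; congr Quat; ring.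
Qed.

Lemma mulq_conj q : q * qconj q = qreal (qnorm2 q).
Proof.
by case: q => a b c d; rewrite quatE /qnorm2 /qreal /=; congr Quat; ring.
Qed.

Lemma mul_conjq q : qconj q * q = qreal (qnorm2 q).
Proof.
by case: q => a b c d; rewrite quatE /qnorm2 /qreal /=; congr Quat; ring.
Qed.

(** The Cayley-Hamilton relation: a quaternion is a root of its real characteristic polynomial, so a
    square can be traded for a linear term. *)
Lemma qsqr q : q * q = qreal (2 * qre q) * q - qreal (qnorm2 q).
Proof.
by case: q => a b c d; rewrite /qreal /qnorm2 /= !quatE; congr Quat; ring.
Qed.

Lemma qre_conj_mul p q : qre (qconj p * q * p) = qnorm2 p * qre q.
Proof.
by case: p => a b c d; case: q => *; rewrite /qnorm2 /qconj !quatE /=; ring.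
Qed.

Lemma qre_real_mul (x : R) q : qre (qreal x * q) = x * qre q.
Proof. by case: q => a b c d; rewrite /qreal !quatE /=; ring. Qed.

End Quaternions.

(** * Division, and monic quadratic equations with three roots *)

Section QuaternionDivision.
Variable R : realFieldType.
Implicit Types p q y : quaternion R.

Lemma qnorm2_ge0 q : 0 <= qnorm2 q.
Proof. by rewrite /qnorm2 !addr_ge0 ?sqr_ge0. Qed.

Lemma qnorm2_eq0 q : (qnorm2 q == 0) = (q == 0).
Proof.
apply/eqP/eqP => [|->]; last by rewrite /qnorm2 /= expr0n /= !addr0.
case: q => a b c d; rewrite /qnorm2 /= => h.
by rewrite zeroqE; congr Quat; apply/eqP; rewrite -sqrf_eq0; apply/eqP; nra.
Qed.

Lemma qconj_fixed q : qconj q = q -> q = qreal (qre q).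
Proof. by case: q => a b c d [*]; rewrite /qreal; congr Quat => //=; lra. Qed.

Lemma qinv_exists q : q != 0 -> exists v, q * v = 1 /\ v * q = 1.
Proof.
rewrite -qnorm2_eq0 => q0; exists (qconj q * qreal (qnorm2 q)^-1); split.
  by rewrite mulrA mulq_conj -qrealM divff.
by rewrite -qreal_comm -mulrA mul_conjq -qrealM mulVf.
Qed.

Lemma qmulf_eq0 p q : p * q = 0 -> p = 0 \/ q = 0.
Proof.
move=> /eqP; rewrite -qnorm2_eq0 qnorm2M mulf_eq0 !qnorm2_eq0.
by case/orP => /eqP; [left|right].
Qed.

Lemma qmulfI p q1 q2 : p != 0 -> p * q1 = p * q2 -> q1 = q2.
Proof.
move=> p0 /eqP; rewrite -subr_eq0 -mulrBr => /eqP /qmulf_eq0 [/eqP|/eqP].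
  by rewrite (negPf p0).
by rewrite subr_eq0 => /eqP.
Qed.

(* If z is the difference of two roots of y^2 + p y + r and v = z^-1, then v
   satisfies the equation 1 + y0 v + v (y0 + p) = 0, which is affine in v. *)
Lemma qquadratic_linearize p r y0 y :
  y0 * y0 + p * y0 + r = 0 -> y * y + p * y + r = 0 -> y != y0 ->
  exists v, v * (y - y0) = 1 /\ 1 + y0 * v + v * (y0 + p) = 0.
Proof.
move=> h0 h yy0; have : y - y0 != 0 by rewrite subr_eq0.
move=> /qinv_exists [v [zv vz]]; exists v; split=> //.
set z := y - y0 in zv vz.
have hz : z * z + z * y0 + (y0 + p) * z = 0.
  have -> : z * z + z * y0 + (y0 + p) * z =
      (y * y + p * y + r) - (y0 * y0 + p * y0 + r).
    rewrite /z; move: (y) (y0) (p) (r) => [????] [????] [????] [????].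
    by rewrite !quatE; congr Quat; ring.
  by rewrite h h0 subrr.
move: (y0 + p) hz => s hz; clearbody z.
(* Sandwiching between two copies of [v] lowers the degree: the square of [z] becomes 1, and each
   linear term in [z] a linear term in [v]. *)
have := congr1 (fun x => v * x * v) hz.
have -> : v * (z * z + z * y0 + s * z) * v =
    (v * z) * (z * v) + (v * z) * y0 * v + v * s * (z * v).
  by rewrite !(mulrDl, mulrDr) !mulrA.
by rewrite mulr0 mul0r zv vz !mul1r mulr1.
Qed.

(** Subtracting the affine equations of the two inverse differences [v1] and [v2] leaves
    [y0 * D = - (D * (y0 + p))] with [D] nonzero. So [y0] and [- (y0 + p)] are conjugate and have
    the same real part. *)
Lemma qquadratic_three_roots_re p r y0 y1 y2 :
  y0 * y0 + p * y0 + r = 0 -> y1 * y1 + p * y1 + r = 0 ->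
  y2 * y2 + p * y2 + r = 0 -> y1 != y0 -> y2 != y0 -> y1 != y2 ->
  2 * qre y0 = - qre p.
Proof.
move=> h0 h1 h2 n1 n2 n12.
have [v1 [z1 e1]] := qquadratic_linearize h0 h1 n1.
have [v2 [z2 e2]] := qquadratic_linearize h0 h2 n2.
pose D := v1 - v2.
have D0 : D != 0.
  apply/eqP => /eqP; rewrite subr_eq0 => /eqP v12.
  have v0 : v1 != 0.
    by apply/eqP => v0; move: z1; rewrite v0 mul0r => /esym/eqP; rewrite oner_eq0.
  move/eqP: n12; apply; apply: (addIr (- y0)); apply: (qmulfI (p := v1)) => //.
  by rewrite z1 v12 z2.
have hD : y0 * D = - (D * (y0 + p)).
  apply/eqP; rewrite -subr_eq0 opprK; apply/eqP.
  have -> : y0 * D + D * (y0 + p) =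
      (1 + y0 * v1 + v1 * (y0 + p)) - (1 + y0 * v2 + v2 * (y0 + p)).
    rewrite /D; move: (v1) (v2) (y0) (p) => [????] [????] [????] [????].
    by rewrite !quatE; congr Quat; ring.
  by rewrite e1 e2 subrr.
(* After multiplication by [qconj D], both real parts carry the factor [qnorm2 D], which cancels. *)
have := congr1 (fun x => qre (qconj D * x)) hD.
rewrite mulrA qre_conj_mul mulrN mulrA mul_conjq qreN qre_real_mul -mulrN.
rewrite -qnorm2_eq0 in D0; move/(mulfI D0); rewrite qreD => e.
by rewrite mulr_natl mulr2n {2}e; ring.
Qed.

(** By Vieta, a root other than [x1] must be [- s - x1]. *)
Lemma monic_quadratic_three_roots (F : fieldType) (s t x1 x2 x3 : F) :
  x1 ^+ 2 + s * x1 + t = 0 -> x2 ^+ 2 + s * x2 + t = 0 ->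
  x3 ^+ 2 + s * x3 + t = 0 -> x1 != x2 -> x1 != x3 -> x2 = x3.
Proof.
move=> h1 h2 h3 n2 n3.
have aux x : x ^+ 2 + s * x + t = 0 -> x1 != x -> x = - s - x1.
  rewrite -subr_eq0 => h n; apply/eqP; rewrite -subr_eq0.
  have : (x1 - x) * (x - (- s - x1)) = 0.
    transitivity ((x1 ^+ 2 + s * x1 + t) - (x ^+ 2 + s * x + t)); first by ring.
    by rewrite h1 h subrr.
  by move/eqP; rewrite mulf_eq0 (negPf n).
by rewrite (aux x2) // (aux x3).
Qed.

Lemma qquadratic_three_roots p r y0 y1 y2 :
  y0 * y0 + p * y0 + r = 0 -> y1 * y1 + p * y1 + r = 0 ->
  y2 * y2 + p * y2 + r = 0 -> y1 != y0 -> y2 != y0 -> y1 != y2 ->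
  p = qreal (qre p) /\ r = qreal (qnorm2 y0).
Proof.
move=> h0 h1 h2 n1 n2 n12.
have e0 := qquadratic_three_roots_re h0 h1 h2 n1 n2 n12.
have e1 : 2 * qre y1 = - qre p.
  by apply: (qquadratic_three_roots_re h1 h0 h2) => //; rewrite eq_sym.
have e2 : 2 * qre y2 = - qre p.
  by apply: (qquadratic_three_roots_re h2 h0 h1) => //; rewrite eq_sym.
(* [P] is the imaginary part of [p]; the claim on [p] is that it vanishes. *)
pose P := p - qreal (qre p).
have root y : y * y + p * y + r = 0 -> 2 * qre y = - qre p ->
    P * y = qreal (qnorm2 y) - r.
  move=> h e; apply/eqP; rewrite -subr_eq0 -h qsqr e.
  apply/eqP; rewrite /P; move: (qnorm2 y) => n.
  move: (y) (p) (r) => [????] [????] [????].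
  by rewrite /qreal /= !quatE; congr Quat; ring.
have [P0|/negP P0] := boolP (P == 0).
  move/eqP: P0 => P0; split; first by apply/eqP; rewrite -subr_eq0; apply/eqP.
  have := root _ h0 e0; rewrite P0 mul0r => /esym/eqP.
  by rewrite subr_eq0 => /eqP.
(* Here y = P^-1 (|y|^2 - r), and taking norms makes |y|^2 a root of a monic
   real quadratic. *)
move/negP in P0; exfalso.
have quad y : y * y + p * y + r = 0 -> 2 * qre y = - qre p ->
    qnorm2 y ^+ 2 + (- 2 * qre r - qnorm2 P) * qnorm2 y + qnorm2 r = 0.
  move=> h e; have := congr1 (@qnorm2 R) (root _ h e); rewrite qnorm2M => H.
  transitivity (qnorm2 (qreal (qnorm2 y) - r) - qnorm2 P * qnorm2 y).
    move: (qnorm2 y) (qnorm2 P) => n m; case: (r) => a b c d.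
    by rewrite /qreal !quatE /qnorm2 /=; ring.
  by rewrite H subrr.
(* Since [P] is invertible, [P * y = |y|^2 - r] recovers [y] from its norm, so three roots would
   have three distinct norms. *)
have inj y y' : y * y + p * y + r = 0 -> 2 * qre y = - qre p ->
    y' * y' + p * y' + r = 0 -> 2 * qre y' = - qre p ->
    y != y' -> qnorm2 y != qnorm2 y'.
  move=> h e h' e' /eqP yy'; apply/eqP => nn; apply: yy'.
  by apply: (qmulfI (p := P)) => //; rewrite !root // nn.
have := monic_quadratic_three_roots (quad _ h0 e0) (quad _ h1 e1) (quad _ h2 e2).
move/(_ (inj _ _ h0 e0 h1 e1 _) (inj _ _ h0 e0 h2 e2 _)).
rewrite eq_sym n1 eq_sym n2 => /(_ isT isT) /eqP.
by rewrite (negPf (inj _ _ h1 e1 h2 e2 n12)).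
Qed.

End QuaternionDivision.

(** * Left eigenvalues of 2 x 2 symplectic matrices *)

Section LeftEigenvalues2.
Variable R : realFieldType.
Implicit Types (A : 'M[quaternion R]_2) (l : quaternion R).

Lemma ord2P (i : 'I_2) : i = 0 \/ i = 1.
Proof. by case: i => [[|[|//]] hi]; [left|right]; apply/val_inj. Qed.

Lemma left_eigenvalue2P A l : left_eigenvalue A l <->
  exists x y, [/\ (x != 0) || (y != 0), A 0 0 * x + A 0 1 * y = l * x &
                  A 1 0 * x + A 1 1 * y = l * y].
Proof.
have mulE (u : 'cV[quaternion R]_2) i :
    (A *m u) i 0 = A i 0 * u 0 0 + A i 1 * u 1 0.
  rewrite mxE !big_ord_recl big_ord0 addr0.
  by have -> : lift ord0 ord0 = 1 :> 'I_2 by apply/val_inj.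
split=> [[u u0 /matrixP e]|[x [y [xy ex ey]]]].
  exists (u 0 0), (u 1 0); split; last 2 first.
  - by have := e 0 0; rewrite mulE mxE.
  - by have := e 1 0; rewrite mulE mxE.
  apply: contraNT u0; rewrite negb_or !negbK => /andP[/eqP ux /eqP uy].
  apply/eqP/matrixP => i j; rewrite ord1 mxE.
  by case: (ord2P i) => ->.
exists (\col_i (if i == 0 then x else y)).
  apply: contraTneq xy => /matrixP e; rewrite negb_or !negbK.
  by have := e 0 0; have := e 1 0; rewrite !mxE /= => -> ->; rewrite eqxx.
apply/matrixP => i j; rewrite ord1 mulE !mxE /=.
by case: (ord2P i) => -> /=.
Qed.

Lemma left_eigenvalue_diag A l : A 0 1 = 0 -> A 1 0 = 0 ->
  left_eigenvalue A l -> l = A 0 0 \/ l = A 1 1.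
Proof.
move=> b0 c0 /left_eigenvalue2P [x [y [xy]]]; rewrite b0 c0 !mul0r addr0 add0r.
have aux a z : z != 0 -> a * z = l * z -> l = a.
  move=> z0 /eqP; rewrite -subr_eq0 -mulrBl => /eqP /qmulf_eq0 [/eqP|/eqP].
    by rewrite subr_eq0 => /eqP ->.
  by rewrite (negPf z0).
by case/orP: xy => n0 e1 e2; [left|right]; apply: aux n0 _.
Qed.

(* The eigenvector is normalised to (1, y). *)
Lemma left_eigenvalue_affine A l : A 0 1 != 0 -> left_eigenvalue A l ->
  exists y, l = A 0 0 + A 0 1 * y /\ A 1 0 + A 1 1 * y = l * y.
Proof.
move=> b0 /left_eigenvalue2P [x [y [xy ex ey]]].
have x0 : x != 0.
  apply/eqP => x0; move: xy ex; rewrite x0 eqxx /= !mulr0 add0r => y0.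
  by case/qmulf_eq0 => /eqP; rewrite ?(negPf b0) ?(negPf y0).
have [v [xv vx]] := qinv_exists x0.
exists (y * v); split.
  by have := congr1 ( *%R^~ v) ex; rewrite mulrDl -!mulrA xv !mulr1.
by have := congr1 ( *%R^~ v) ey; rewrite mulrDl -!mulrA xv !mulr1.
Qed.

Lemma symplectic2_entries A : symplectic A ->
  [/\ qnorm2 (A 0 0) + qnorm2 (A 1 0) = 1, qnorm2 (A 0 1) + qnorm2 (A 1 1) = 1 &
      qconj (A 0 0) * A 0 1 + qconj (A 1 0) * A 1 1 = 0].
Proof.
have mulE i j : (conjtr A *m A) i j =
    qconj (A 0 i) * A 0 j + qconj (A 1 i) * A 1 j.
  rewrite mxE !big_ord_recl big_ord0 addr0 !mxE.
  by have -> : lift ord0 ord0 = 1 :> 'I_2 by apply/val_inj.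
move=> /matrixP h; split.
- by have := congr1 (@qre R) (h 0 0); rewrite mulE !mxE !mul_conjq.
- by have := congr1 (@qre R) (h 1 1); rewrite mulE !mxE !mul_conjq.
- by have := h 0 1; rewrite mulE !mxE.
Qed.

(** Write a, b, c, d for the entries. Orthogonality of the columns gives |a|^2 |b|^2 = |c|^2 |d|^2.
    As the columns are unit, this reads (1 - |c|^2) |b|^2 = |c|^2 (1 - |b|^2). *)
Lemma symplectic2_offdiag A : symplectic A -> qnorm2 (A 1 0) = qnorm2 (A 0 1).
Proof.
move=> /symplectic2_entries [e1 e2 /eqP]; rewrite addr_eq0 => /eqP.
move/(congr1 (@qnorm2 R)); rewrite qnorm2N !qnorm2M !qnorm2_conj => e.
by move: e1 e2 e; move: (qnorm2 _) (qnorm2 _) (qnorm2 _) (qnorm2 _) => *; nra.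
Qed.

Lemma symplectic2_three_left_eigenvalues A l0 l1 l2 : symplectic A ->
  left_eigenvalue A l0 -> left_eigenvalue A l1 -> left_eigenvalue A l2 ->
  l1 != l0 -> l2 != l0 -> l1 != l2 ->
  [/\ A 0 1 != 0, A 1 0 = - A 0 1, A 1 1 = A 0 0 &
      exists x : R, A 0 0 = A 0 1 * qreal x].
Proof.
move=> hA h0 h1 h2 n1 n2 n12.
have Nbc := symplectic2_offdiag hA.
have [E1 E2 E3] := symplectic2_entries hA.
have b0 : A 0 1 != 0.
  (* Otherwise [A] is diagonal, and three distinct eigenvalues would have to fit among its two
     diagonal entries. *)
  apply/eqP => b0; have c0 : A 1 0 = 0.
    by apply/eqP; rewrite -qnorm2_eq0 Nbc qnorm2_eq0 b0.
  move: n1 n2 n12.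
  case: (left_eigenvalue_diag b0 c0 h0) => ->;
  case: (left_eigenvalue_diag b0 c0 h1) => ->;
  by case: (left_eigenvalue_diag b0 c0 h2) => ->; rewrite ?eqxx.
have [v [bv vb]] := qinv_exists b0.
(* Eliminating l between l = a + b y and c + d y = l y gives b y^2 + (a - d) y - c = 0; left
   division by b makes it monic. *)
pose p := v * (A 0 0 - A 1 1); pose r := - (v * A 1 0).
have eqn l : left_eigenvalue A l ->
    exists y, l = A 0 0 + A 0 1 * y /\ y * y + p * y + r = 0.
  move=> /(left_eigenvalue_affine b0) [y [el ey]]; exists y; split=> //.
  apply: (qmulfI b0); rewrite mulr0 !mulrDr mulrN !mulrA bv !mul1r.
  transitivity ((A 0 0 + A 0 1 * y) * y - (A 1 0 + A 1 1 * y)).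
    move: (A 0 0) (A 0 1) (A 1 0) (A 1 1) (y) => [????] [????] [????] [????] [????].
    by rewrite !quatE; congr Quat; ring.
  by rewrite -el ey subrr.
have [y0 [el0 r0]] := eqn _ h0.
have [y1 [el1 r1]] := eqn _ h1.
have [y2 [el2 r2]] := eqn _ h2.
have neq x y : A 0 0 + A 0 1 * x != A 0 0 + A 0 1 * y -> x != y.
  by apply: contraNneq => ->.
have [preal rreal] : p = qreal (qre p) /\ r = qreal (qnorm2 y0).
  by apply: (qquadratic_three_roots r0 r1 r2); apply: neq;
    rewrite -?el0 -?el1 -?el2.
have bp : A 0 1 * p = A 0 0 - A 1 1 by rewrite mulrA bv mul1r.
have br : A 0 1 * r = - A 1 0 by rewrite mulrN mulrA bv mul1r.
have Nb0 : qnorm2 (A 0 1) != 0 by rewrite qnorm2_eq0.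
(* From b r = - c and |c| = |b| follows |r| = 1, while r is the nonnegative real |y0|^2. *)
have ny0 : qnorm2 y0 = 1.
  have := congr1 (@qnorm2 R) br; rewrite qnorm2N Nbc qnorm2M rreal qnorm2_real.
  rewrite -[RHS]mulr1 => /(mulfI Nb0) /eqP.
  rewrite sqrf_eq1 => /orP[/eqP //|/eqP e].
  by have := qnorm2_ge0 y0; rewrite e; lra.
have cb : A 1 0 = - A 0 1.
  by rewrite -[LHS]opprK -br rreal ny0 -[qreal 1]/(1 : quaternion R) mulr1.
have da : A 1 1 = A 0 0 - A 0 1 * p by rewrite bp opprB addrC subrK.
(* Orthogonality of the columns now reads conj(a) b - conj(b) a + |b|^2 p = 0. The first two terms
   have an imaginary difference, so the real part is |b|^2 p = 0. *)
have p0 : p = 0.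
  move: E3; rewrite cb da preal; move: (qre p) Nb0 => x; clear.
  case: (A 0 1) (A 0 0) => [a b c d] [a' b' c' d'].
  rewrite /qnorm2 /qreal /= !quatE => Nb0 [e _ _ _].
  suff -> : x = 0 by [].
  apply: (mulfI Nb0); rewrite mulr0 -[RHS]e; ring.
have {}da : A 1 1 = A 0 0 by rewrite da p0 mulr0 subr0.
(* The witness is the quotient of a by b; it is real because orthogonality now says that conj(b) a
   is its own conjugate. *)
split=> //; exists (qre (qconj (A 0 1) * A 0 0) / qnorm2 (A 0 1)).
have wreal : qconj (A 0 1) * A 0 0 = qreal (qre (qconj (A 0 1) * A 0 0)).
  apply: qconj_fixed; rewrite qconjM qconjK.
  move: E3; rewrite cb da qconjN mulNr => /eqP.
  by rewrite subr_eq0 => /eqP.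
rewrite qrealM -wreal !mulrA mulq_conj qreal_comm -mulrA -qrealM divff //.
by rewrite -[qreal 1]/(1 : quaternion R) mulr1.
Qed.

End LeftEigenvalues2.

(** * From infinitely many eigenvalues to the rotation form, and back *)

Lemma infinite_set_three (T : eqType) (E : set T) : infinite_set E ->
  exists x y z, [/\ E x, E y, E z, y != x & z != x /\ y != z].
Proof.
move=> Einf; have [x Ex] := infinite_setN0 Einf.
have [y [Ey /eqP yx]] := infinite_setN0 (infinite_setD Einf (finite_set1 x)).
have [z [Ez zxy]] := infinite_setN0 (infinite_setD Einf (finite_set2 x y)).
exists x, y, z; split=> //; split; first by apply/eqP => e; apply: zxy; left.
by apply/eqP => e; apply: zxy; right.
Qed.

Theorem theorem6p2 (R : realType) (A : 'M[quaternion R]_2)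
    (hA : symplectic A) :
  infinite_set [set lambda : quaternion R | left_eigenvalue A lambda] <->
  exists (q : quaternion R) (theta : R),
    [/\ qnorm q = 1, sin theta != 0 &
        A = mx22 (q * qreal (cos theta)) (- (q * qreal (sin theta)))
                 (q * qreal (sin theta)) (q * qreal (cos theta))].
Proof.
split=> [Einf|[q [th [q1 s0 ->]]]].
  have [l0 [l1 [l2 [/= B0 B1 B2 n1 [n2 n12]]]]] := infinite_set_three Einf.
  have [b0 cb da [x ax]] :=
    symplectic2_three_left_eigenvalues hA B0 B1 B2 n1 n2 n12.
  have [E1 _ _] := symplectic2_entries hA.
  set b := A 0 1 in b0 cb ax.
  have Nb0 : 0 < qnorm2 b by rewrite lt_def qnorm2_eq0 b0 qnorm2_ge0.
  have sb0 : qnorm b != 0 by rewrite /qnorm gt_eqF ?sqrtr_gt0.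
  have sqb : qnorm b ^+ 2 = qnorm2 b by rewrite /qnorm sqr_sqrtr // qnorm2_ge0.
  have E : (x * qnorm b) ^+ 2 + qnorm b ^+ 2 = 1.
    rewrite -E1 ax cb qnorm2M qnorm2_real qnorm2N exprMn sqb; ring.
  have cle : -1 <= - (x * qnorm b) <= 1.
    have := sqr_ge0 (qnorm b); rewrite lerNl opprK lerNl => ?.
    by apply/andP; split; nra.
  (* Matching b = - q sin theta with sin theta = |b| forces q = - b / |b|, and then a = b x forces
     cos theta = - x |b|. The choice of [acos] agrees with this sign, its sine being nonnegative. *)
  exists (- (b * qreal (qnorm b)^-1)), (acos (- (x * qnorm b))).
  rewrite acosK ?in_itv //= sin_acos //.
  have -> : 1 - (- (x * qnorm b)) ^+ 2 = qnorm b ^+ 2 by rewrite -E; ring.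
  have -> : Num.sqrt (qnorm b ^+ 2) = qnorm b.
    by rewrite sqrtr_sqr ger0_norm ?sqrtr_ge0.
  split=> //.
    rewrite /qnorm -[X in Num.sqrt X]/(qnorm2 _) qnorm2N qnorm2M qnorm2_real.
    by rewrite exprVn sqb divff ?sqrtr1 // gt_eqF.
  have bE : - (b * qreal (qnorm b)^-1) * qreal (qnorm b) = - b.
    by rewrite mulNr -mulrA -qrealM mulVf // -[qreal 1]/(1 : quaternion R) mulr1.
  have aE : - (b * qreal (qnorm b)^-1) * qreal (- (x * qnorm b)) = A 0 0.
    rewrite ax mulNr -mulrA -qrealM mulrN mulrCA mulVf // mulr1 -mulrN.
    by congr (_ * _); rewrite /qreal quatE; congr Quat; rewrite ?opprK ?oppr0.
  rewrite bE aE opprK; apply/matrixP => i j; rewrite mxE.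
  by case: (ord2P i) => ->; case: (ord2P j) => ->.
(* For every y with y^2 = -1, the vector (1, y) is an eigenvector for q (cos th - y sin th). The
   points y = x n i + z n j of the unit circle supply infinitely many such y. *)
pose x n : R := n.+1%:R^-1; pose z n : R := Num.sqrt (1 - x n ^+ 2).
have xz n : x n ^+ 2 + z n ^+ 2 = 1.
  rewrite /z sqr_sqrtr ?subrKC // subr_ge0 expr_le1 ?invr_ge0 ?ler0n //.
  by rewrite invf_le1 ?ltr0n // ler1n.
pose l n := q * Quat (cos th) (- (sin th * x n)) (- (sin th * z n)) 0.
have q0 : q != 0.
  apply/eqP => e; move: q1; rewrite e /qnorm /= expr0n /= !addr0 sqrtr0.
  by move=> /esym/eqP; rewrite oner_eq0.
(* After cancelling [q], the i-component alone determines [n], as [sin th] is nonzero. *)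
have linj : injective l.
  move=> n m /(qmulfI q0) [/oppr_inj /(mulfI s0) /invr_inj /eqP + _].
  by rewrite eqr_nat => /eqP [].
move=> Efin; apply: infinite_nat.
have := finite_preimage (f := l) (fun n m _ _ => @linj n m) Efin.
apply: sub_finite_set => n _ /=.
apply/left_eigenvalue2P; exists 1, (Quat 0 (x n) (z n) 0).
rewrite oner_eq0 !mxE /= !mulr1; split=> //.
  rewrite /l; case: (q) => ????; rewrite /qreal !quatE; congr Quat; ring.
rewrite /l -!mulrA -mulrDr; congr (q * _).
rewrite /qreal !quatE; congr Quat; try by ring.
(* The remaining component is the real one, where y^2 = -1 enters through [xz]. *)
by rewrite -[LHS]mulr1 -(xz n); ring.
Qed.
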